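(* Let $X$ be a second countable Baire complex topological vector space and $\Gamma$ a subset of $\mathcal{B}(X)$. If $\Gamma$ satisfies the criterion of hypercyclicity, then $\Gamma$ is topologically transitive. As a consequence, $\Gamma$ is hypercyclic.
   Context: $\mathcal{B}(X)$ denotes the set of all continuous linear operators on $X$. A set $\Gamma\subset\mathcal{B}(X)$ satisfies the criterion of hypercyclicity if there exist two dense subsets $X_0$ and $Y_0$ of $X$, a sequence $(T_k)_{k\ge 1}$ of operators in $\Gamma$, and a sequence of maps $S_k: Y_0\to X$ ($k\ge 1$; not assumed linear or continuous) such that, as $k\to\infty$: (i) $T_kx\to 0$ for all $x\in X_0$; (ii) $S_ky\to 0$ for all $y\in Y_0$; (iii) $T_kS_ky\to y$ for all $y\in Y_0$. $\Gamma$ is topologically transitive if for each pair $(U,V)$ of nonempty open subsets of $X$ there exists $T\in\Gamma$ such that $T(U)\cap V\neq\emptyset$. $\Gamma$ is hypercyclic if there exists $x\in X$ such that $Orb(\Gamma,x)=\{Tx : T\in\Gamma\}$ is dense in $X$. *)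

(* Defs.v *)
From HB Require Import structures.
From mathcomp Require Import all_boot all_order all_algebra.
From mathcomp Require Import all_classical all_reals all_analysis.
From mathcomp Require Import complex.

Set Implicit Arguments.
Unset Strict Implicit.
Unset Printing Implicit Defensive.

Import Order.TTheory GRing.Theory Num.Theory.
Import numFieldNormedType.Exports.

Local Open Scope classical_set_scope.
Local Open Scope ring_scope.

Definition baire_space (X : topologicalType) : Prop :=
  forall F : (set X)^nat,
    (forall n, open (F n) /\ dense (F n)) -> dense (\bigcap_n F n).

Section Operators.
Context {K : numDomainType} {X : topologicalLmodType K}.

Definition continuous_operators : set {linear X -> X} :=
  [set T | continuous T].

(* The maps [S k] are arbitrary functions defined on the subset [Y0] only: the
   set [Y0] is coerced to the corresponding subtype of [X]. *)
Definition hypercyclicity_criterion (Gamma : set {linear X -> X}) : Prop :=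
  exists (X0 Y0 : set X) (T : nat -> {linear X -> X}) (S : nat -> Y0 -> X),
    [/\ dense X0, dense Y0 & forall k, Gamma (T k)] /\
    [/\ forall x, X0 x -> T k x @[k --> \oo] --> (0 : X),
        forall y : Y0, S k y @[k --> \oo] --> (0 : X) &
        forall y : Y0, T k (S k y) @[k --> \oo] --> (val y : X)].

Definition topologically_transitive (Gamma : set {linear X -> X}) : Prop :=
  forall U V : set X, open U -> U !=set0 -> open V -> V !=set0 ->
    exists2 T, Gamma T & (T @` U) `&` V !=set0.

Definition operator_orbit (Gamma : set {linear X -> X}) (x : X) : set X :=
  [set T x | T in Gamma].

Definition hypercyclic (Gamma : set {linear X -> X}) : Prop :=
  exists x : X, dense (operator_orbit Gamma x).

End Operators.

(* Main.v *)
Require Import Defs.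
From HB Require Import structures.
From mathcomp Require Import all_boot all_order all_algebra.
From mathcomp Require Import all_classical all_reals all_analysis.
From mathcomp Require Import complex.

Import Order.TTheory GRing.Theory Num.Theory.
Import numFieldNormedType.Exports.

Local Open Scope classical_set_scope.
Local Open Scope ring_scope.

(** Transitivity is a perturbation argument.  Given nonempty open [U] and [V],
    density supplies [x] in [U] on which the operators [T k] die out and [y] in
    [V] with approximate preimages [S k y] that themselves tend to [0].  The
    point [x + S k y] is then a small perturbation of [x], while its image
    [T k x + T k (S k y)] is close to [y]; so for large [k] it lies in [U] and
    is sent into [V] ([criterion_transitive]).

    Hypercyclicity then follows from Birkhoff's category argument
    ([transitive_hypercyclic]).  The vectors some operator of [Gamma] sends into
    a given nonempty open set [V] form a set [hitting_set Gamma V], which is open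
    by continuity and dense by transitivity.  A vector has dense orbit as soon as
    it lies in [hitting_set Gamma V] for every nonempty [V] of a countable basis,
    and the Baire property makes the intersection of these countably many dense
    open sets dense, hence nonempty. *)

Section HypercyclicFamilies.
Context {K : numDomainType} {X : topologicalLmodType K}.
Implicit Type Gamma : set {linear X -> X}.

Lemma sequence_cvgD {u v : nat -> X} {a b : X} :
  u @ \oo --> a -> v @ \oo --> b -> u k + v k @[k --> \oo] --> a + b.
Proof. by move=> ua vb; exact: (cvg_comp2 ua vb (@add_continuous X (a, b))). Qed.

Lemma criterion_transitive Gamma :
  hypercyclicity_criterion Gamma -> topologically_transitive Gamma.
Proof.
move=> [X0 [Y0 [T [S [[dX0 dY0 GT] [Tx0 Sy0 TSy]]]]]] U V oU U0 oV V0.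
have [x [Ux X0x]] := dX0 _ U0 oU.
have [y [Vy Y0y]] := dY0 _ V0 oV.
pose y' : Y0 := exist _ y (mem_set Y0y).
have xS : x + S k y' @[k --> \oo] --> x.
  by rewrite -[X in _ --> X]addr0; exact: (sequence_cvgD (cvg_cst x) (Sy0 y')).
have TxS : T k (x + S k y') @[k --> \oo] --> y.
  under eq_cvg do rewrite linearD.
  by rewrite -[y]add0r; exact: (sequence_cvgD (Tx0 x X0x) (TSy y')).
have [k [kU kV]] : exists k, U (x + S k y') /\ V (T k (x + S k y')).
  apply: (@filter_ex _ (\oo : set_system nat)); apply: filterI.
    by apply: xS; exact: open_nbhs_nbhs.
  by apply: TxS; exact: open_nbhs_nbhs.
by exists (T k) => //; exists (T k (x + S k y')); split => //; exists (x + S k y').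
Qed.

Definition hitting_set Gamma (V : set X) : set X :=
  \bigcup_(T in Gamma) T @^-1` V.

Lemma open_hitting_set Gamma V :
  Gamma `<=` continuous_operators -> open V -> open (hitting_set Gamma V).
Proof.
move=> cG oV; apply: bigcup_open => T GT.
by apply: open_comp => // x _; exact: cG.
Qed.

Lemma dense_hitting_set Gamma V :
  topologically_transitive Gamma -> open V -> V !=set0 ->
  dense (hitting_set Gamma V).
Proof.
move=> tG oV V0 U U0 oU.
have [T GT [_ [[x Ux <-] VTx]]] := tG U V oU U0 oV V0.
by exists x; split => //; exists T.
Qed.

(** Only the nonempty members of the basis are enumerated, since the hitting
    set of an empty one would be empty and would spoil the intersection. *)
Lemma transitive_hypercyclic Gamma :
  @second_countable X -> baire_space X -> Gamma `<=` continuous_operators ->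
  topologically_transitive Gamma -> hypercyclic Gamma.
Proof.
move=> [B cB [oB nB]] baireX cG tG.
have hit_dense (x : X) :
    (forall V, B V -> V !=set0 -> hitting_set Gamma V x) ->
    dense (operator_orbit Gamma x).
  move=> hit W [w Ww] oW.
  have [V [BV Vw] VW] : filter_from [set V | B V /\ V w] id W.
    by apply: nB; exact: open_nbhs_nbhs.
  have [|T GT VTx] := hit V BV; first by exists w.
  by exists (T x); split; [exact: VW|exists T].
have : countable [set V | B V /\ V !=set0].
  by apply: sub_countable cB; apply: subset_card_le => V [].
case/pfcard_geP => [noV|[f]].
  (* With no nonempty basic set at all, the condition on [x] is vacuous. *)
  exists 0; apply: hit_dense => V BV V0.
  by have : [set V | B V /\ V !=set0] V by []; rewrite noV.
have fP n : B (f n) /\ f n !=set0 by exact: (funS (s := f)).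
have /baireX dense_hit n :
    open (hitting_set Gamma (f n)) /\ dense (hitting_set Gamma (f n)).
  have [Bf f0] := fP n; have of_ := oB _ Bf.
  by split; [exact: open_hitting_set|exact: dense_hitting_set].
have [x [_ xhit]] := dense_hit setT (ex_intro _ 0 I) openT.
exists x; apply: hit_dense => V BV V0.
have [n _ <-] := surj (f := f) (conj BV V0).
exact: xhit.
Qed.

End HypercyclicFamilies.

Theorem theorem3p12 (R : realType) (X : topologicalLmodType R[i])
    (hsc : @second_countable X) (hbaire : baire_space X)
    (Gamma : set {linear X -> X})
    (hGamma : Gamma `<=` continuous_operators) :
  hypercyclicity_criterion Gamma ->
  topologically_transitive Gamma /\ hypercyclic Gamma.
Proof.
move=> /criterion_transitive tG; split=> //.
exact: transitive_hypercyclic.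
Qed.
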